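(* Let $\{\rho_1,\dots,\rho_m\}$ be a virtually clonable set of quantum states on $\mathbb{C}^d$. Then the optimal cloning cost for $\{\rho_1,\dots,\rho_m\}$ equals the optimal value of the following semidefinite program: $$\begin{aligned}\min_{J_\pm,\,\lambda_\pm}\quad & \lambda_++\lambda_-\\ \text{s.t.}\quad & \operatorname{Tr}_R\big[(\rho_i^T\otimes \mathbb{1}_{SS'})(J_+-J_-)\big]=\rho_i\otimes\rho_i,\quad i=1,\dots,m,\\ & \operatorname{Tr}_{SS'}(J_+)=\lambda_+\mathbb{1}_R,\quad \operatorname{Tr}_{SS'}(J_-)=\lambda_-\mathbb{1}_R,\\ & J_+\ge 0,\quad J_-\ge 0,\end{aligned}$$ where $\lambda_\pm$ are real numbers and $J_\pm$ are Hermitian matrices on the Hilbert space $\mathcal{H}_R\otimes\mathcal{H}_S\otimes\mathcal{H}_{S'}$ with $\mathcal{H}_R=\mathcal{H}_S=\mathcal{H}_{S'}=\mathbb{C}^d$.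
   Context: A quantum state on $\mathbb{C}^d$ is a positive semidefinite operator of trace $1$. An HPTP map is a complex-linear map between operator spaces that preserves Hermiticity and the trace; a CPTP map is a completely positive trace-preserving linear map. A set of states $\{\rho_1,\dots,\rho_m\}$ on $\mathbb{C}^d$ is virtually clonable if there is an HPTP map $\tilde\Lambda$ from operators on $\mathbb{C}^d$ to operators on $\mathbb{C}^d\otimes\mathbb{C}^d$ with $\tilde\Lambda(\rho_i)=\rho_i\otimes\rho_i$ for all $i$. The optimal cloning cost for a virtually clonable set is the minimum of $\lambda_++\lambda_-$ over all $\lambda_\pm\ge 0$, CPTP maps $\Lambda_\pm$ and HPTP maps $\tilde\Lambda$ (all from operators on $\mathbb{C}^d$ to operators on $\mathbb{C}^d\otimes\mathbb{C}^d$) such that $\tilde\Lambda=\lambda_+\Lambda_+-\lambda_-\Lambda_-$ and $\tilde\Lambda(\rho_i)=\rho_i\otimes\rho_i$ for $i=1,\dots,m$. The transpose $T$ is taken in the fixed computational basis, $\operatorname{Tr}_R$ and $\operatorname{Tr}_{SS'}$ are the partial traces over $\mathcal{H}_R$ and over $\mathcal{H}_S\otimes\mathcal{H}_{S'}$, and $\mathbb{1}$ denotes identity operators. *)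

(* Defs.v *)
From HB Require Import structures.
From mathcomp Require Import all_boot all_order all_algebra.
From mathcomp Require Import all_classical all_reals.
From mathcomp Require Export complex mxtens.

Set Implicit Arguments.
Unset Strict Implicit.
Unset Printing Implicit Defensive.

Import Order.TTheory GRing.Theory Num.Theory.

Local Open Scope classical_set_scope.
Local Open Scope ring_scope.
Local Open Scope sesquilinear_scope.
Local Open Scope complex_scope.

(* Operators on C^d are matrices over R[i] in the computational basis, and
   C^m (x) C^n is C^(m * n) through mxtens_index, so that the tensor product of
   operators is the Kronecker product [A *t B]. *)

Section Operators.
Variable R : realType.
Local Notation C := R[i].

(* [0 <= z] in R[i] means that z is real and nonnegative. *)
Definition psdmx n (A : 'M[C]_n) : Prop :=
  A \is hermsymmx /\ forall v : 'cV[C]_n, 0 <= (v ^t* *m A *m v) 0 0.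

Definition is_state n (A : 'M[C]_n) : Prop := psdmx A /\ \tr A = 1.

Definition ptrace1 m n (A : 'M[C]_(m * n)) : 'M[C]_n :=
  \matrix_(i, j) \sum_(k < m) A (mxtens_index (k, i)) (mxtens_index (k, j)).

Definition ptrace2 m n (A : 'M[C]_(m * n)) : 'M[C]_m :=
  \matrix_(i, j) \sum_(k < n) A (mxtens_index (i, k)) (mxtens_index (j, k)).

Definition tens_block k n (X : 'M[C]_(k * n)) (a b : 'I_k) : 'M[C]_n :=
  \matrix_(i, j) X (mxtens_index (a, i)) (mxtens_index (b, j)).

(* The map id (x) F on operators on C^k (x) C^p: an operator X is the sum of
   the |a><b| (x) X_ab. *)
Definition id_tens k p q (F : 'M[C]_p -> 'M[C]_q) (X : 'M[C]_(k * p)) :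
    'M[C]_(k * q) :=
  \sum_(a < k) \sum_(b < k) delta_mx a b *t F (tens_block X a b).

Definition hermiticity_preserving p q (F : 'M[C]_p -> 'M[C]_q) : Prop :=
  forall X, X \is hermsymmx -> F X \is hermsymmx.

Definition trace_preserving p q (F : 'M[C]_p -> 'M[C]_q) : Prop :=
  forall X, \tr (F X) = \tr X.

Definition completely_positive p q (F : 'M[C]_p -> 'M[C]_q) : Prop :=
  forall k (X : 'M[C]_(k * p)), psdmx X -> psdmx (id_tens F X).

Definition HPTP p q (F : {linear 'M[C]_p -> 'M[C]_q}) : Prop :=
  hermiticity_preserving F /\ trace_preserving F.

Definition CPTP p q (F : {linear 'M[C]_p -> 'M[C]_q}) : Prop :=
  completely_positive F /\ trace_preserving F.

End Operators.

Definition is_minimum (R : realType) (A : set R) (c : R) : Prop :=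
  A c /\ lbound A c.

Section Cloning.
Variables (R : realType) (d m : nat) (rho : 'I_m -> 'M[R[i]]_d).
Local Notation C := R[i].

Definition clones (F : 'M[C]_d -> 'M[C]_(d * d)) : Prop :=
  forall i, F (rho i) = rho i *t rho i.

Definition virtually_clonable : Prop :=
  exists F : {linear 'M[C]_d -> 'M[C]_(d * d)}, HPTP F /\ clones F.

Definition cloning_decomposition (lp lm : R)
    (Fp Fm F : {linear 'M[C]_d -> 'M[C]_(d * d)}) : Prop :=
  [/\ 0 <= lp /\ 0 <= lm, CPTP Fp /\ CPTP Fm, HPTP F,
      (forall X, F X = lp%:C *: Fp X - lm%:C *: Fm X) & clones F].

Definition cloning_costs : set R :=
  [set c | exists lp lm Fp Fm F,
      cloning_decomposition lp lm Fp Fm F /\ c = lp + lm].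

(* [inf] is only meaningful as a minimum when it is attained, see
   [is_minimum]. *)
Definition optimal_cloning_cost : R := inf cloning_costs.

(* The tensor factors are ordered as R (x) (S (x) S'): [ptrace1] is the partial
   trace over R and [ptrace2] the one over S and S'. *)
Definition sdp_feasible (Jp Jm : 'M[C]_(d * (d * d))) (lp lm : R) : Prop :=
  [/\ (forall i, ptrace1 (((rho i)^T *t 1%:M) *m (Jp - Jm)) = rho i *t rho i),
      ptrace2 Jp = (lp%:C)%:M, ptrace2 Jm = (lm%:C)%:M, psdmx Jp & psdmx Jm].

Definition sdp_values : set R :=
  [set c | exists Jp Jm lp lm, sdp_feasible Jp Jm lp lm /\ c = lp + lm].

Definition sdp_optimal_value : R := inf sdp_values.

End Cloning.

(* Main.v *)
From HB Require Import structures.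
Require Import Defs.
From mathcomp Require Import all_boot all_order all_algebra.
From mathcomp Require Import all_classical all_reals all_analysis.
From mathcomp Require Import ring.

Set Implicit Arguments.
Unset Strict Implicit.
Unset Printing Implicit Defensive.

Import Order.TTheory GRing.Theory Num.Theory.
Import numFieldNormedType.Exports.
Local Open Scope classical_set_scope.
Local Open Scope ring_scope.
Local Open Scope sesquilinear_scope.
Local Open Scope complex_scope.

(** The Choi matrix [J = sum_ab E_ab (x) F(E_ab)] of a linear map [F] turns the
    cloning problem into the semidefinite program: [F] is recovered from [J] by
    [F X = Tr_R((X^T (x) 1) J)], complete positivity of [F] is [J >= 0], and
    trace preservation is [Tr_SS' J = 1].  Scaling by [lambda_+-] makes the
    achievable costs and the feasible values the same set; only [lambda = 0]
    needs care, where [J] has trace 0, hence vanishes, and any CPTP map will do.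
    That set is nonempty since the Hermitian Choi matrix [J] of an HPTP cloner
    is [(J + c 1) - c 1] with [J + c 1 >= 0] for large [c].  Its infimum is
    attained: entries of a positive semidefinite matrix are bounded by its
    trace, here [d lambda_+-], so bounded cost confines the feasible pairs to a
    compact set. *)

(** * Positive semidefinite matrices *)

Section PositiveSemidefinite.
Context {R : realType}.
Local Notation C := R[i].

Lemma hermsymmxP n (A : 'M[C]_n) :
  reflect (forall i j, A i j = Num.conj (A j i)) (A \is hermsymmx).
Proof.
apply: (iffP idP) => [/is_hermitianmxP + i j|AE].
  by move=> /matrixP/(_ i j); rewrite expr0 scale1r !mxE.
by apply/is_hermitianmxP/matrixP => i j; rewrite expr0 scale1r !mxE.
Qed.

Lemma quadform_sumE n (A : 'M[C]_n) (v : 'cV[C]_n) :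
  (v ^t* *m A *m v) 0 0 =
  \sum_i \sum_j Num.conj (v i 0) * A i j * v j 0.
Proof.
rewrite mxE exchange_big; apply: eq_bigr => j _ /=.
by rewrite mxE mulr_suml; apply: eq_bigr => i _; rewrite !mxE.
Qed.

(** The quadratic form at [v] equals the sum over [t] of the squared moduli of
    [\sum_j g t j * v j 0]. The index type [T] is left free so that rank-one matrices ([unit]) and
    products of two Gram families (pairs) are covered alike. *)
Lemma gram_psdmx n (T : finType) (g : T -> 'I_n -> C) (A : 'M[C]_n) :
  (forall i j, A i j = \sum_t Num.conj (g t i) * g t j) -> psdmx A.
Proof.
move=> AE; split=> [|v].
  apply/hermsymmxP => i j; rewrite !AE rmorph_sum; apply: eq_bigr => t _.
  by rewrite rmorphM /= conjCK mulrC.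
rewrite quadform_sumE.
suff -> : \sum_i \sum_j Num.conj (v i 0) * A i j * v j 0 =
    \sum_t (\sum_j g t j * v j 0) * Num.conj (\sum_j g t j * v j 0).
  by apply: sumr_ge0 => t _; exact: mul_conjC_ge0.
under eq_bigr do under eq_bigr do rewrite AE mulr_sumr mulr_suml.
under eq_bigr do rewrite exchange_big.
rewrite exchange_big; apply: eq_bigr => t _ /=.
rewrite rmorph_sum mulr_sumr; apply: eq_bigr => i _.
rewrite mulr_suml; apply: eq_bigr => j _.
by rewrite rmorphM /=; ring.
Qed.

(** By the spectral theorem [A] is [P^t* D P] with [P] unitary and [D] diagonal. Positivity makes
    [D] nonnegative, and the rows of [P] scaled by the square roots of the eigenvalues form [B]. *)
Lemma psdmx_gram n (A : 'M[C]_n) : psdmx A ->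
  exists B : 'M[C]_n, forall i j, A i j = \sum_l Num.conj (B l i) * B l j.
Proof.
move=> [Aherm Apos].
have /orthomx_spectralP AE := hermitian_normalmx Aherm.
set P := spectralmx A in AE; set D := spectral_diag A in AE.
have PU : P \is unitarymx := spectral_unitarymx A.
rewrite invmx_unitary // in AE.
have D_ge0 l : 0 <= D 0 l.
  have -> : D 0 l = (P *m A *m P^t*) l l.
    rewrite [in P *m A]AE !mulmxA (unitarymxP PU) mul1mx.
    rewrite -mulmxA (unitarymxP PU) mulmx1.
    by rewrite !mxE eqxx.
  (* The conjugated row [l] of [P] is an eigenvector, and the quadratic form there is the eigenvalue
     [D 0 l]. *)
  have := Apos (\col_i Num.conj (P l i)).
  rewrite quadform_sumE exchange_big /=; congr (0 <= _).
  rewrite [RHS]mxE; apply: eq_bigr => j _; rewrite [(P *m A) l j]mxE mulr_suml.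
  by apply: eq_bigr => i _; rewrite !mxE conjCK.
exists (\matrix_(l, j) (sqrtC (D 0 l) * P l j)) => i j.
rewrite {1}AE mxE; apply: eq_bigr => l _; rewrite mul_mx_diag !mxE rmorphM /=.
rewrite [Num.conj (sqrtC _)]geC0_conj ?sqrtC_ge0 // mulrACA -expr2 sqrtCK.
by rewrite mulrA; congr (_ * _); rewrite mulrC.
Qed.

Lemma hermitian_add_scalar_psd n (A : 'M[C]_n) : A \is hermsymmx ->
  exists2 c : R, 0 <= c & psdmx (A + (c%:C)%:M).
Proof.
move=> Aherm.
have /mxOverP Dreal := hermitian_spectral_diag_real Aherm.
have /orthomx_spectralP AE := hermitian_normalmx Aherm.
set P := spectralmx A in AE; set D := spectral_diag A in AE Dreal.
have PU : P \is unitarymx := spectral_unitarymx A.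
rewrite invmx_unitary // in AE.
(* The sum of the absolute values of the eigenvalues dominates each of them, so the shift by [c]
   leaves no negative eigenvalue. *)
pose c : R := \sum_l `|complex.Re (D 0 l)|.
have c_ge0 : 0 <= c by apply: sumr_ge0.
exists c => //.
have Dc_ge0 l : 0 <= D 0 l + c%:C.
  rewrite -[D 0 l]RRe_real ?Dreal // -rmorphD ler0c /c (bigD1 l) //= addrA.
  apply: addr_ge0; last by apply: sumr_ge0.
  by rewrite addrC -lerBlDr sub0r (le_trans (ler_norm _)) // normrN.
apply: (@gram_psdmx _ _ (fun l i => sqrtC (D 0 l + c%:C) * P l i)) => i j.
have -> : A + (c%:C)%:M = P^t* *m diag_mx (D + const_mx c%:C) *m P.
  rewrite linearD mulmxDr mulmxDl -AE /= diag_const_mx mul_mx_scalar.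
  rewrite -scalemxAl -invmx_unitary // mulVmx ?unitarymx_unit //.
  by rewrite scalemx1.
rewrite mxE; apply: eq_bigr => l _; rewrite mul_mx_diag !mxE rmorphM /=.
rewrite [Num.conj (sqrtC _)]geC0_conj ?sqrtC_ge0 // mulrACA -expr2 sqrtCK.
by rewrite mulrA; congr (_ * _); rewrite mulrC.
Qed.

Lemma psdmxZ n (A : 'M[C]_n) (a : R) :
  0 <= a -> psdmx A -> psdmx (a%:C *: A).
Proof.
move=> a_ge0 /psdmx_gram[B AE].
apply: (@gram_psdmx _ _ (fun l i => sqrtC a%:C * B l i)) => i j.
rewrite mxE AE mulr_sumr; apply: eq_bigr => l _.
rewrite rmorphM /= [Num.conj (sqrtC _)]geC0_conj ?sqrtC_ge0 ?ler0c //.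
by rewrite mulrACA -expr2 sqrtCK.
Qed.

Lemma psdmx_scalar n (a : R) : 0 <= a -> psdmx ((a%:C)%:M : 'M[C]_n).
Proof.
move=> a_ge0; rewrite -scalemx1; apply: psdmxZ => //.
apply: (@gram_psdmx _ _ (fun l i => (l == i)%:R)) => i j.
rewrite mxE (bigD1 i) //= eqxx rmorph1 mul1r big1 ?addr0 // => l /negPf ->.
by rewrite rmorph0 mul0r.
Qed.

Lemma psdmx_diag_ge0 n (A : 'M[C]_n) i : psdmx A -> 0 <= A i i.
Proof.
move=> /psdmx_gram[B ->]; apply: sumr_ge0 => l _.
by rewrite mulrC mul_conjC_ge0.
Qed.

(** With a Gram factor [B], the inequality [2xy <= x^2 + y^2] applied to [|B l i|] and [|B l j|] and
    summed over [l] gives [2|A i j| <= A i i + A j j]. Each diagonal entry is at most the trace;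
    bounding the two separately also covers [i = j]. *)
Lemma psdmx_entry_le_trace n (A : 'M[C]_n) i j : psdmx A -> `|A i j| <= \tr A.
Proof.
move=> Apsd; have [B AE] := psdmx_gram Apsd.
have diag_le k : A k k <= \tr A.
  rewrite /mxtrace (bigD1 k) //= lerDl; apply: sumr_ge0 => l _.
  exact: psdmx_diag_ge0.
rewrite -(@ler_pM2l _ 2) //.
apply: (@le_trans _ _ (A i i + A j j)); last first.
  by rewrite mulr_natl mulr2n lerD.
rewrite !AE -big_split /=.
apply: (@le_trans _ _ (\sum_l 2 * `|Num.conj (B l i) * B l j|)).
  by rewrite -mulr_sumr ler_pM2l // ler_norm_sum.
apply: ler_sum => l _; rewrite normrM norm_conjC.
rewrite -![Num.conj _ * _]mulrC -!normCK -subr_ge0.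
have -> : `|B l i| ^+ 2 + `|B l j| ^+ 2 - 2 * (`|B l i| * `|B l j|) =
    (`|B l i| - `|B l j|) ^+ 2 by ring.
by rewrite -realEsqr rpredB ?normr_real.
Qed.

End PositiveSemidefinite.

(** * The Choi correspondence *)

Section Choi.
Context {R : realType}.
Local Notation C := R[i].

Lemma sum_mxtens_index (V : nmodType) m n (f : 'I_(m * n) -> V) :
  \sum_k f k = \sum_i \sum_j f (mxtens_index (i, j)).
Proof.
rewrite pair_big_dep /= (reindex (@mxtens_index m n)) /=.
  by apply: eq_bigr => -[i j].
by exists (@mxtens_unindex m n) => k _;
  rewrite (mxtens_indexK, mxtens_unindexK).
Qed.

Lemma exchange_big2 (V : nmodType) (I J K L : finType)
    (f : I -> J -> K -> L -> V) :
  \sum_i \sum_j \sum_k \sum_l f i j k l =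
  \sum_k \sum_l \sum_i \sum_j f i j k l.
Proof.
transitivity (\sum_i \sum_k \sum_j \sum_l f i j k l).
  by apply: eq_bigr => i _; exact: exchange_big.
rewrite exchange_big; apply: eq_bigr => k _.
rewrite [RHS]exchange_big; apply: eq_bigr => i _.
exact: exchange_big.
Qed.

Lemma matrix_tensP m n (A B : 'M[C]_(m * n)) :
  (forall a i b j, A (mxtens_index (a, i)) (mxtens_index (b, j)) =
                   B (mxtens_index (a, i)) (mxtens_index (b, j))) -> A = B.
Proof.
move=> AB; apply/matrixP => x y.
by case: (mxtens_indexP x) => a i; case: (mxtens_indexP y) => b j.
Qed.

Definition choi p q (F : 'M[C]_p -> 'M[C]_q) : 'M[C]_(p * q) :=
  \matrix_(x, y) F (delta_mx (mxtens_unindex x).1 (mxtens_unindex y).1)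
                   (mxtens_unindex x).2 (mxtens_unindex y).2.

(** This is the inverse Choi correspondence, written exactly as the left side of the cloning
    constraint in [sdp_feasible], so that the two agree by conversion. *)
Definition choi_map p q (J : 'M[C]_(p * q)) (X : 'M[C]_p) : 'M[C]_q :=
  ptrace1 ((X^T *t 1%:M) *m J).

Lemma choiE p q (F : 'M[C]_p -> 'M[C]_q) a i b j :
  choi F (mxtens_index (a, i)) (mxtens_index (b, j)) = F (delta_mx a b) i j.
Proof. by rewrite mxE !mxtens_indexK. Qed.

Lemma choi_mapE p q (J : 'M[C]_(p * q)) (X : 'M[C]_p) i j :
  choi_map J X i j =
  \sum_a \sum_b X a b * J (mxtens_index (a, i)) (mxtens_index (b, j)).
Proof.
rewrite mxE exchange_big; apply: eq_bigr => b _.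
rewrite mxE sum_mxtens_index; apply: eq_bigr => a _ /=.
rewrite (bigD1 i) //= tensmxE !mxE eqxx mulr1 big1 ?addr0 // => k /negPf nki.
by rewrite tensmxE !mxE eq_sym nki mulr0 mul0r.
Qed.

Lemma choi_map_is_linear p q (J : 'M[C]_(p * q)) : linear (choi_map J).
Proof.
move=> a X Y; apply/matrixP => i j.
rewrite [RHS]mxE [X in _ = X + _]mxE !choi_mapE mulr_sumr.
rewrite -big_split; apply: eq_bigr => k _ /=; rewrite mulr_sumr -big_split.
by apply: eq_bigr => l _ /=; rewrite !mxE mulrDl mulrA.
Qed.

HB.instance Definition _ p q (J : 'M[C]_(p * q)) :=
  GRing.isLinear.Build C 'M[C]_p 'M[C]_q _ (choi_map J)
    (@choi_map_is_linear p q J).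

Lemma choi_mapB p q (J K : 'M[C]_(p * q)) X :
  choi_map (J - K) X = choi_map J X - choi_map K X.
Proof.
apply/matrixP => i j; rewrite /choi_map mulmxBr !mxE -sumrB.
by apply: eq_bigr => k _; rewrite !mxE.
Qed.

Lemma choi_mapZ p q (J : 'M[C]_(p * q)) a X :
  choi_map (a *: J) X = a *: choi_map J X.
Proof.
apply/matrixP => i j; rewrite /choi_map -scalemxAr !mxE mulr_sumr.
by apply: eq_bigr => k _; rewrite !mxE.
Qed.

Lemma choiK p q (F : {linear 'M[C]_p -> 'M[C]_q}) X : choi_map (choi F) X = F X.
Proof.
apply/matrixP => i j; rewrite choi_mapE [in RHS](matrix_sum_delta X).
rewrite linear_sum summxE; apply: eq_bigr => a _.
rewrite linear_sum summxE; apply: eq_bigr => b _.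
by rewrite choiE linearZ [RHS]mxE.
Qed.

Lemma trace_choi_map p q (J : 'M[C]_(p * q)) X :
  \tr (choi_map J X) = \sum_a \sum_b X a b * ptrace2 J a b.
Proof.
rewrite /mxtrace; under eq_bigr do rewrite choi_mapE.
rewrite exchange_big; apply: eq_bigr => a _ /=.
rewrite exchange_big; apply: eq_bigr => b _ /=.
by rewrite mxE mulr_sumr.
Qed.

Lemma trace_choi_map_scalar p q (J : 'M[C]_(p * q)) c X :
  ptrace2 J = c%:M -> \tr (choi_map J X) = c * \tr X.
Proof.
move=> Jc; rewrite trace_choi_map mulr_sumr; apply: eq_bigr => a _.
rewrite Jc (bigD1 a) //= mxE eqxx mulr1n mulrC big1 ?addr0 // => b /negPf nba.
by rewrite mxE eq_sym nba mulr0n mulr0.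
Qed.

(** The entry at [(a, b)] is the trace of [F (delta_mx a b)], hence that of the matrix unit
    itself. *)
Lemma ptrace2_choi p q (F : 'M[C]_p -> 'M[C]_q) :
  trace_preserving F -> ptrace2 (choi F) = 1%:M.
Proof.
move=> Ftp; apply/matrixP => a b.
rewrite mxE; under eq_bigr do rewrite choiE.
have := Ftp (delta_mx a b); rewrite /mxtrace => ->.
rewrite [RHS]mxE; have [->|nab] := eqVneq a b.
  rewrite (bigD1 b) //= mxE !eqxx big1 ?addr0 // => k /negPf nk.
  by rewrite mxE nk.
by apply: big1 => k _; rewrite mxE; case: eqP => // ->; rewrite (negPf nab).
Qed.

Lemma hermiticity_preserving_choi_map p q (J : 'M[C]_(p * q)) :
  J \is hermsymmx -> hermiticity_preserving (choi_map J).
Proof.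
move=> /hermsymmxP JE X /hermsymmxP XE; apply/hermsymmxP => i j.
rewrite !choi_mapE rmorph_sum exchange_big; apply: eq_bigr => b _ /=.
rewrite rmorph_sum; apply: eq_bigr => a _ /=.
by rewrite rmorphM /= -XE -JE.
Qed.

Lemma id_tensE k p q (F : 'M[C]_p -> 'M[C]_q) (X : 'M[C]_(k * p)) a i b j :
  id_tens F X (mxtens_index (a, i)) (mxtens_index (b, j)) =
  F (tens_block X a b) i j.
Proof.
rewrite /id_tens summxE (bigD1 a) //= summxE (bigD1 b) //= tensmxE mxE !eqxx.
rewrite mul1r big1 ?addr0 => [|b' /negPf nb].
  rewrite big1 ?addr0 // => a' /negPf na; rewrite summxE big1 // => b' _.
  by rewrite tensmxE mxE eq_sym na mul0r.
by rewrite tensmxE mxE [b == _]eq_sym nb andbF mul0r.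
Qed.

(** The entry of [id_tens (choi_map J) X] at [(a, i)], [(b, j)] is the contraction over [c], [e] of
    X at [(a, c)], [(b, e)] with J at [(c, i)], [(e, j)]. If [D] and [B] are Gram factors of [X] and
    [J], contracting [D] with [B] over the shared index gives the Gram family [g], indexed by pairs
    of rows. *)
Lemma completely_positive_choi_map p q (J : 'M[C]_(p * q)) :
  psdmx J -> completely_positive (choi_map J).
Proof.
move=> /psdmx_gram[B JE] k X /psdmx_gram[D XE].
pose g (t : 'I_(k * p) * 'I_(p * q)) x :=
  \sum_c D t.1 (mxtens_index ((mxtens_unindex x).1, c)) *
         B t.2 (mxtens_index (c, (mxtens_unindex x).2)).
apply: (@gram_psdmx _ _ _ g) => x y.
case: (mxtens_indexP x) => a i; case: (mxtens_indexP y) => b j.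
rewrite id_tensE choi_mapE -(pair_bigA _ (fun s t =>
  Num.conj (g (s, t) (mxtens_index (a, i))) * g (s, t) (mxtens_index (b, j)))).
rewrite /g !mxtens_indexK /=.
transitivity (\sum_c \sum_e \sum_s \sum_t
   Num.conj (D s (mxtens_index (a, c)) * B t (mxtens_index (c, i))) *
   (D s (mxtens_index (b, e)) * B t (mxtens_index (e, j)))).
  apply: eq_bigr => c _; apply: eq_bigr => e _.
  rewrite mxE XE JE mulr_suml; apply: eq_bigr => s _.
  rewrite mulr_sumr; apply: eq_bigr => t _.
  by rewrite rmorphM /= mulrACA.
rewrite exchange_big2; apply: eq_bigr => s _; apply: eq_bigr => t _.
rewrite rmorph_sum mulr_suml; apply: eq_bigr => c _.
by rewrite mulr_sumr.
Qed.

(* The Choi matrix is the image under id (x) F of the unnormalised maximally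
   entangled state. *)
Lemma psdmx_choi p q (F : 'M[C]_p -> 'M[C]_q) :
  completely_positive F -> psdmx (choi F).
Proof.
pose w (x : 'I_(p * p)) : C := ((mxtens_unindex x).1 == (mxtens_unindex x).2)%:R.
pose W : 'M[C]_(p * p) := \matrix_(x, y) (w x * w y).
have -> : choi F = id_tens F W.
  apply: matrix_tensP => a i b j; rewrite choiE id_tensE; congr (F _ _ _).
  apply/matrixP => k l; rewrite !mxE /w !mxtens_indexK /=.
  by rewrite -natrM mulnb [k == _]eq_sym [l == _]eq_sym.
apply; apply: (@gram_psdmx _ _ unit (fun _ x => w x)) => x y.
by rewrite mxE (big_pred1 tt) => [|[]//]; rewrite /w rmorph_nat.
Qed.

(* Splitting 2 F(E_ab) = F(E_ab + E_ba) - i F(i (E_ab - E_ba)) reduces the claim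
   to Hermitian inputs. *)
Lemma hermsymmx_choi p q (F : {linear 'M[C]_p -> 'M[C]_q}) :
  hermiticity_preserving F -> choi F \is hermsymmx.
Proof.
move=> Fhp; apply/hermsymmxP => x y.
case: (mxtens_indexP x) => a i; case: (mxtens_indexP y) => b j; rewrite !choiE.
set Eab : 'M[C]_p := delta_mx a b; set Eba : 'M[C]_p := delta_mx b a.
have EabC k l : Num.conj (Eab k l) = Eba l k.
  by rewrite !mxE rmorph_nat andbC.
have EbaC k l : Num.conj (Eba k l) = Eab l k by rewrite -EabC conjCK.
have Sherm : Eab + Eba \is hermsymmx.
  by apply/hermsymmxP => k l; rewrite mxE [in RHS]mxE rmorphD /= EabC EbaC addrC.
have Therm : 'i%R *: (Eab - Eba) \is hermsymmx.
  apply/hermsymmxP => k l.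
  rewrite mxE [in RHS]mxE [(Eab - Eba) k l]mxE [(Eab - Eba) l k]mxE.
  rewrite [(- Eba) k l]mxE [(- Eba) l k]mxE.
  by rewrite rmorphM rmorphB /= EabC EbaC conjCi mulNr -mulrN opprB.
have /hermsymmxP/(_ i j) := Fhp _ Sherm; have /hermsymmxP/(_ i j) := Fhp _ Therm.
rewrite linearZ linearB linearD /= !mxE rmorphM rmorphB rmorphD /= conjCi.
rewrite mulNr -mulrN opprB => /(mulfI (neq0Ci _)) eqB eqD.
have two_neq0 : (2 : C) != 0 by rewrite pnatr_eq0.
apply: (mulfI two_neq0).
transitivity ((F Eab i j + F Eba i j) + (F Eab i j - F Eba i j)); first by ring.
by rewrite eqD eqB; ring.
Qed.
End Choi.

(** * Cloning costs are feasible values *)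

Section CostsAsValues.
Context {R : realType}.
Local Notation C := R[i].

Lemma psdmx_trace0 n (A : 'M[C]_n) : psdmx A -> \tr A = 0 -> A = 0.
Proof.
move=> Apsd trA0; apply/matrixP => i j; rewrite mxE; apply/eqP.
by rewrite -normr_le0 -trA0 psdmx_entry_le_trace.
Qed.

Lemma trace_ptrace2 p q (J : 'M[C]_(p * q)) : \tr (ptrace2 J) = \tr J.
Proof.
rewrite /mxtrace sum_mxtens_index; apply: eq_bigr => a _.
by rewrite mxE.
Qed.

Lemma ptrace2Z p q a (J : 'M[C]_(p * q)) : ptrace2 (a *: J) = a *: ptrace2 J.
Proof.
apply/matrixP => i j; rewrite !mxE mulr_sumr.
by apply: eq_bigr => k _; rewrite mxE.
Qed.

Lemma ptrace2D p q (J K : 'M[C]_(p * q)) :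
  ptrace2 (J + K) = ptrace2 J + ptrace2 K.
Proof.
apply/matrixP => i j; rewrite !mxE -big_split.
by apply: eq_bigr => k _; rewrite mxE.
Qed.

Lemma ptrace2_scalar p q (c : C) :
  ptrace2 (c%:M : 'M[C]_(p * q)) = (c *+ q)%:M.
Proof.
apply/matrixP => i j; rewrite !mxE.
under eq_bigr do rewrite mxE (can_eq (@mxtens_indexK _ _)) xpair_eqE eqxx andbT.
by rewrite sumr_const card_ord mulrnAC.
Qed.

Lemma CPTP_choi_map p q (J : 'M[C]_(p * q)) :
  psdmx J -> ptrace2 J = 1%:M -> CPTP (choi_map J).
Proof.
move=> Jpsd Jtr; split; first exact: completely_positive_choi_map.
by move=> X; rewrite (trace_choi_map_scalar _ Jtr) mul1r.
Qed.

Lemma CPTP_exists p q : (0 < q)%N ->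
  exists F : {linear 'M[C]_p -> 'M[C]_q}, CPTP F.
Proof.
move=> q_gt0; have qC_neq0 : (q%:R : C) != 0 by rewrite pnatr_eq0 -lt0n.
(* This is the completely depolarizing map, sending [X] to [\tr X / q] times the identity. *)
exists (choi_map ((q%:R^-1 : R)%:C%:M)); apply: CPTP_choi_map.
  by apply: psdmx_scalar; rewrite invr_ge0.
by rewrite ptrace2_scalar fmorphV rmorph_nat -[X in X%:M]mulr_natr mulVf.
Qed.

(** This recovers the sign conditions of [cloning_decomposition], which [sdp_feasible] does not
    state. Since [0 < p] there is a diagonal entry to look at, and it is a sum of diagonal entries
    of [J]. *)
Lemma ptrace2_ge0 p q (J : 'M[C]_(p * q)) (c : R) : (0 < p)%N ->
  psdmx J -> ptrace2 J = (c%:C)%:M -> 0 <= c.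
Proof.
move=> p_gt0 Jpsd /matrixP/(_ (Ordinal p_gt0) (Ordinal p_gt0)).
rewrite !mxE eqxx mulr1n -ler0c => <-.
by apply: sumr_ge0 => k _; exact: psdmx_diag_ge0.
Qed.

(** For [c > 0] the map has Choi matrix [J / c]. For [c = 0] both sides vanish, and [0 < q] ensures
    that some CPTP map exists to serve as [F]. *)
Lemma choi_map_scaled_CPTP p q (J : 'M[C]_(p * q)) (c : R) : (0 < q)%N ->
  psdmx J -> 0 <= c -> ptrace2 J = (c%:C)%:M ->
  exists F : {linear 'M[C]_p -> 'M[C]_q},
    CPTP F /\ forall X, choi_map J X = c%:C *: F X.
Proof.
move=> q_gt0 Jpsd; rewrite le_eqVlt => /predU1P[<- Jtr|c_gt0 Jtr].
  have J0 : J = 0 *: J.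
    rewrite scale0r; apply: psdmx_trace0 => //.
    by rewrite -trace_ptrace2 Jtr mxtrace_scalar mul0rn.
  have [F Fcptp] := CPTP_exists p q_gt0; exists F; split=> // X.
  by rewrite J0 choi_mapZ !scale0r.
have cC_neq0 : c%:C != 0 by rewrite gt_eqF // ltcR.
exists (choi_map ((c^-1)%:C *: J)); split=> [|X].
  apply: CPTP_choi_map; first by apply: psdmxZ => //; rewrite invr_ge0 ltW.
  by rewrite ptrace2Z Jtr scale_scalar_mx fmorphV mulVf.
by rewrite /= choi_mapZ scalerA fmorphV mulfV // scale1r.
Qed.

Lemma trace_tens p q (A : 'M[C]_p) (B : 'M[C]_q) : \tr (A *t B) = \tr A * \tr B.
Proof.
rewrite /mxtrace sum_mxtens_index mulr_suml; apply: eq_bigr => i _.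
by rewrite mulr_sumr; apply: eq_bigr => j _; rewrite tensmxE.
Qed.

(** In dimension 0 the trace is an empty sum and cannot be 1. *)
Lemma is_state_dim_gt0 n (A : 'M[C]_n) : is_state A -> (0 < n)%N.
Proof.
move=> [_]; case: n A => // A /eqP.
by rewrite /mxtrace big_ord0 eq_sym oner_eq0.
Qed.

Section Cloning.
Variables (d m : nat) (rho : 'I_m -> 'M[C]_d).
Hypothesis m_gt0 : (0 < m)%N.
Hypothesis rho_state : forall i, is_state (rho i).

Let d_gt0 : (0 < d)%N.
Proof. exact: is_state_dim_gt0 (rho_state (Ordinal m_gt0)). Qed.

Lemma cloning_costs_eq_sdp_values : cloning_costs rho = sdp_values rho.
Proof.
apply/seteqP; split=> [c [lp [lm [Fp [Fm [F [[]]]]]]]|c [Jp [Jm [lp [lm []]]]]].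
  move=> [lp_ge0 lm_ge0] [[Fp_cp Fp_tp] [Fm_cp Fm_tp]] _ FE Fclones ->.
  exists (lp%:C *: choi Fp), (lm%:C *: choi Fm), lp, lm; split=> //; split.
  - move=> i; rewrite -Fclones FE -/(choi_map _ _) choi_mapB !choi_mapZ.
    by rewrite !choiK.
  - by rewrite ptrace2Z ptrace2_choi // scalemx1.
  - by rewrite ptrace2Z ptrace2_choi // scalemx1.
  - exact/psdmxZ/psdmx_choi.
  - exact/psdmxZ/psdmx_choi.
move=> [Jclones Jp_tr Jm_tr Jp_psd Jm_psd] ->.
have dd_gt0 : (0 < d * d)%N by rewrite muln_gt0 d_gt0.
have lp_ge0 := ptrace2_ge0 d_gt0 Jp_psd Jp_tr.
have lm_ge0 := ptrace2_ge0 d_gt0 Jm_psd Jm_tr.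
have [Fp [Fp_cptp FpE]] := choi_map_scaled_CPTP dd_gt0 Jp_psd lp_ge0 Jp_tr.
have [Fm [Fm_cptp FmE]] := choi_map_scaled_CPTP dd_gt0 Jm_psd lm_ge0 Jm_tr.
exists lp, lm, Fp, Fm, (choi_map (Jp - Jm)); split=> //.
have FE X : choi_map (Jp - Jm) X = lp%:C *: Fp X - lm%:C *: Fm X.
  by rewrite choi_mapB FpE FmE.
have trE X : \tr (choi_map (Jp - Jm) X) = (lp%:C - lm%:C) * \tr X.
  by rewrite FE raddfB /= !mxtraceZ Fp_cptp.2 Fm_cptp.2 mulrBl.
split=> //; split=> [|X].
  apply: hermiticity_preserving_choi_map; apply/hermsymmxP => x y.
  case: Jp_psd Jm_psd => /hermsymmxP JpE _ [/hermsymmxP JmE _].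
  by rewrite !mxE rmorphB /= -JpE -JmE.
(* The program does not impose trace preservation on the difference, whose traces scale by
   [lp - lm]. Evaluating at one cloned state, where both input and output have trace 1, forces
   [lp - lm = 1]. *)
pose i0 := Ordinal m_gt0.
have := trE (rho i0); rewrite [choi_map _ _]Jclones trace_tens.
rewrite (rho_state i0).2 !mulr1 => lpm1.
by rewrite trE -lpm1 mul1r.
Qed.

Lemma sdp_values_nonempty : virtually_clonable rho -> exists c, sdp_values rho c.
Proof.
move=> [F [[Fhp Ftp] Fclones]].
have [c c_ge0 Jc_psd] := hermitian_add_scalar_psd (hermsymmx_choi Fhp).
(* Tracing [c] times the identity over the [d * d]-dimensional output gives [c * d^2], and the Choi
   matrix of the trace-preserving [F] contributes the extra 1. *)
exists ((1 + c *+ (d * d)) + c *+ (d * d)).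
exists (choi F + (c%:C)%:M), (c%:C)%:M, (1 + c *+ (d * d)), (c *+ (d * d)).
split; last by [].
split; [| | |exact: Jc_psd|exact: psdmx_scalar].
- by move=> i; rewrite addrK -Fclones -[RHS]choiK.
- have -> : (1 + c *+ (d * d))%:C = 1 + c%:C *+ (d * d) :> C.
    by rewrite rmorphD rmorph1 rmorphMn.
  by rewrite ptrace2D ptrace2_choi // ptrace2_scalar raddfD.
- have -> : (c *+ (d * d))%:C = c%:C *+ (d * d) :> C by rewrite rmorphMn.
  by rewrite ptrace2_scalar.
Qed.

End Cloning.
End CostsAsValues.

(** * Closedness of the feasible set *)

Section ComplexContinuity.
Context {R : realType} {T : topologicalType}.
Local Notation C := R[i].
Implicit Types f g : T -> C.

(* Phrased on real and imaginary parts, so that no topology on R[i] is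
   involved. *)
Definition complex_continuous f : Prop :=
  continuous (fun x => complex.Re (f x)) /\ continuous (fun x => complex.Im (f x)).

Lemma complex_continuous_cst (c : C) : complex_continuous (fun=> c).
Proof. by split; exact: cst_continuous. Qed.

Lemma complex_continuousD f g : complex_continuous f -> complex_continuous g ->
  complex_continuous (fun x => f x + g x).
Proof.
move=> [fr fi] [gr gi].
split=> x; under eq_fun do rewrite raddfD /=.
  by apply: cvgD; [exact: fr|exact: gr].
by apply: cvgD; [exact: fi|exact: gi].
Qed.

Lemma complex_continuousM f g : complex_continuous f -> complex_continuous g ->
  complex_continuous (fun x => f x * g x).
Proof.
move=> [fr fi] [gr gi]; split=> x.
  have -> : (fun x => complex.Re (f x * g x)) =
      (fun x => complex.Re (f x) * complex.Re (g x) -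
                complex.Im (f x) * complex.Im (g x)).
    by apply/funext => y; case: (f y) (g y) => a b [].
  apply: cvgB; apply: cvgM; [exact: fr|exact: gr|exact: fi|exact: gi].
have -> : (fun x => complex.Im (f x * g x)) =
    (fun x => complex.Re (f x) * complex.Im (g x) +
              complex.Im (f x) * complex.Re (g x)).
  by apply/funext => y; case: (f y) (g y) => a b [].
apply: cvgD; apply: cvgM; [exact: fr|exact: gi|exact: fi|exact: gr].
Qed.

Lemma complex_continuousN f : complex_continuous f ->
  complex_continuous (fun x => - f x).
Proof.
move=> fc; have -> : (fun x => - f x) = (fun x => -1 * f x).
  by apply/funext => x; rewrite mulN1r.
exact: complex_continuousM (complex_continuous_cst _) fc.
Qed.

Lemma complex_continuous_conj f : complex_continuous f ->
  complex_continuous (fun x => Num.conj (f x)).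
Proof.
move=> [fr fi]; split=> x.
  have -> : (fun x => complex.Re (Num.conj (f x))) = (fun x => complex.Re (f x)).
    by apply/funext => y; case: (f y).
  exact: fr.
have -> : (fun x => complex.Im (Num.conj (f x))) = (fun x => - complex.Im (f x)).
  by apply/funext => y; case: (f y).
by apply: cvgN; exact: fi.
Qed.

Lemma complex_continuous_sum (I : Type) (r : seq I) (F : I -> T -> C) :
  (forall i, complex_continuous (F i)) ->
  complex_continuous (fun x => \sum_(i <- r) F i x).
Proof.
move=> Fc; elim: r => [|i r IHr].
  by under eq_fun do rewrite big_nil; exact: complex_continuous_cst.
by under eq_fun do rewrite big_cons; exact: complex_continuousD.
Qed.

Lemma complex_continuous_real (f : T -> R) : continuous f ->
  complex_continuous (fun x => (f x)%:C).
Proof. by move=> fc; split=> //; exact: cst_continuous. Qed.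

Lemma scaled_continuous (a : R) (f : T -> R) :
  continuous f -> continuous (fun x => a * f x).
Proof. by move=> fc x; apply: cvgM; [exact: cvg_cst|exact: fc]. Qed.

Lemma sum2_continuous (f g : T -> R) :
  continuous f -> continuous g -> continuous (fun x => f x + g x).
Proof. by move=> fc gc x; apply: cvgD; [exact: fc|exact: gc]. Qed.

Lemma closed_continuous_le (f g : T -> R) : continuous f -> continuous g ->
  closed [set x | f x <= g x].
Proof.
move=> fc gc.
have -> : [set x | f x <= g x] = (g - f) @^-1` [set y | 0 <= y].
  by apply/seteqP; split=> x /=; rewrite fctE subr_ge0.
apply: preimage_closed (@closed_ge _ _) => x _.
by apply: cvgB; [exact: gc|exact: fc].
Qed.

Lemma closed_continuous_eq (f g : T -> R) : continuous f -> continuous g ->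
  closed [set x | f x = g x].
Proof.
move=> fc gc.
have -> : [set x | f x = g x] = [set x | f x <= g x] `&` [set x | g x <= f x].
  apply/seteqP; split=> x /= => [->|[fg gf]]; first by split.
  by apply/eqP; rewrite eq_le fg gf.
by apply: closedI; exact: closed_continuous_le.
Qed.

Lemma closed_complex_eq f g : complex_continuous f -> complex_continuous g ->
  closed [set x | f x = g x].
Proof.
move=> [fr fi] [gr gi].
have -> : [set x | f x = g x] =
    [set x | complex.Re (f x) = complex.Re (g x)] `&`
    [set x | complex.Im (f x) = complex.Im (g x)].
  apply/seteqP; split=> x /= => [->|[]]; first by [].
  by case: (f x) (g x) => a b [a' b'] /= -> ->.
by apply: closedI; exact: closed_continuous_eq.
Qed.

Lemma closed_complex_ge0 f : complex_continuous f -> closed [set x | 0 <= f x].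
Proof.
move=> [fr fi].
have -> : [set x | 0 <= f x] =
    [set x | complex.Im (f x) = 0] `&` [set x | 0 <= complex.Re (f x)].
  apply/seteqP; split=> x /=; rewrite lecE /=; first by case/andP => /eqP.
  by case=> -> ->; rewrite eqxx.
apply: closedI.
  by apply: closed_continuous_eq => //; exact: cst_continuous.
by apply: closed_continuous_le => //; exact: cst_continuous.
Qed.

Lemma closed_forall (I : Type) (P : I -> T -> Prop) :
  (forall i, closed [set x | P i x]) -> closed [set x | forall i, P i x].
Proof.
move=> Pc; have -> : [set x | forall i, P i x] = \bigcap_i [set x | P i x].
  by apply/seteqP; split=> x Px => [i _|i]; exact: (Px i).
exact: closed_bigI.
Qed.

Definition mx_continuous p q (F : T -> 'M[C]_(p, q)) : Prop :=
  forall i j, complex_continuous (fun x => F x i j).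

Lemma closed_mx_eq p q (F G : T -> 'M[C]_(p, q)) :
  mx_continuous F -> mx_continuous G -> closed [set x | F x = G x].
Proof.
move=> Fc Gc.
have -> : [set x | F x = G x] = [set x | forall i j, F x i j = G x i j].
  by apply/seteqP; split=> x /= => [->//|FG]; apply/matrixP.
by do 2!apply: closed_forall => ?; exact: closed_complex_eq.
Qed.

Lemma mx_continuousB p q (F G : T -> 'M[C]_(p, q)) :
  mx_continuous F -> mx_continuous G -> mx_continuous (fun x => F x - G x).
Proof.
move=> Fc Gc i j; under eq_fun do rewrite !mxE.
by apply: complex_continuousD => //; exact: complex_continuousN.
Qed.

Lemma mx_continuous_choi_map p q (F : T -> 'M[C]_(p * q)) (X : 'M[C]_p) :
  mx_continuous F -> mx_continuous (fun x => choi_map (F x) X).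
Proof.
move=> Fc i j; under eq_fun do rewrite choi_mapE.
do 2!apply: complex_continuous_sum => ?.
exact/complex_continuousM/Fc/complex_continuous_cst.
Qed.

Lemma mx_continuous_ptrace2 p q (F : T -> 'M[C]_(p * q)) :
  mx_continuous F -> mx_continuous (fun x => ptrace2 (F x)).
Proof.
move=> Fc i j; under eq_fun do rewrite mxE.
by apply: complex_continuous_sum => k; exact: Fc.
Qed.

Lemma mx_continuous_scalar n (f : T -> C) :
  complex_continuous f -> mx_continuous (fun x => (f x)%:M : 'M[C]_n).
Proof.
move=> fc i j; under eq_fun do rewrite mxE.
by case: (i == j); [exact: fc|exact: complex_continuous_cst].
Qed.

(** The condition splits into one closed condition per pair of entries and one per fixed vector [v],
    whose quadratic form is a finite sum linear in the entries. *)
Lemma closed_psdmx n (F : T -> 'M[C]_n) :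
  mx_continuous F -> closed [set x | psdmx (F x)].
Proof.
move=> Fc.
have -> : [set x | psdmx (F x)] =
    [set x | forall i j, F x i j = Num.conj (F x j i)] `&`
    [set x | forall v : 'cV[C]_n,
       0 <= \sum_i \sum_j Num.conj (v i 0) * F x i j * v j 0].
  by apply/seteqP; split=> x /= [H1 H2]; (split; first exact/hermsymmxP);
    move=> v; rewrite (quadform_sumE, =^~ quadform_sumE).
apply: closedI.
  do 2!apply: closed_forall => ?; apply: closed_complex_eq => //.
  exact: complex_continuous_conj.
apply: closed_forall => v; apply: closed_complex_ge0.
do 2!apply: complex_continuous_sum => ?.
apply: complex_continuousM (complex_continuous_cst _).
by apply: complex_continuousM => //; exact: complex_continuous_cst.
Qed.

(** The matrices and multipliers depend on a parameter in [T], so that the lemma applies to real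
    coordinate vectors without a topology on complex matrices. *)
Lemma closed_sdp_feasible d m (rho : 'I_m -> 'M[C]_d)
    (Jp Jm : T -> 'M[C]_(d * (d * d))) (lp lm : T -> R) :
  mx_continuous Jp -> mx_continuous Jm -> continuous lp -> continuous lm ->
  closed [set x | sdp_feasible rho (Jp x) (Jm x) (lp x) (lm x)].
Proof.
move=> Jpc Jmc lpc lmc.
have -> : [set x | sdp_feasible rho (Jp x) (Jm x) (lp x) (lm x)] =
    [set x | forall i, choi_map (Jp x - Jm x) (rho i) = rho i *t rho i] `&`
    ([set x | ptrace2 (Jp x) = ((lp x)%:C)%:M] `&`
    ([set x | ptrace2 (Jm x) = ((lm x)%:C)%:M] `&`
    ([set x | psdmx (Jp x)] `&` [set x | psdmx (Jm x)]))).
  apply/seteqP; split=> [x [H1 H2 H3 H4 H5]|x [H1 [H2 [H3 [H4 H5]]]]].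
    exact: (conj H1 (conj H2 (conj H3 (conj H4 H5)))).
  exact: (And5 H1 H2 H3 H4 H5).
apply: closedI.
  apply: closed_forall => i; apply: closed_mx_eq.
    exact/mx_continuous_choi_map/mx_continuousB.
  by move=> k l; exact: complex_continuous_cst.
apply: closedI.
  apply: closed_mx_eq; first exact: mx_continuous_ptrace2.
  exact/mx_continuous_scalar/complex_continuous_real.
apply: closedI.
  apply: closed_mx_eq; first exact: mx_continuous_ptrace2.
  exact/mx_continuous_scalar/complex_continuous_real.
by apply: closedI; exact: closed_psdmx.
Qed.

End ComplexContinuity.

(** * Attainment of the minimum *)

Section Attainment.
Import ArrowAsProduct.
Context {R : realType}.
Local Notation C := R[i].

(** Multiplication by [i] preserves the modulus and turns the imaginary part, up to sign, into the
    real part. *)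
Lemma normc_Im_le (z : C) : `|complex.Im z|%:C <= `|z|.
Proof.
have -> : `|z| = `|z * 'i%C|.
  by rewrite normrM [`|'i%C|]normc_def /= expr0n expr1n add0r sqrtr1 mulr1.
by apply: le_trans (normc_ge_Re _); rewrite ReiNIm normrN.
Qed.

Section Coordinates.
Variables (I : eqType) (n : nat) (coord : bool -> 'I_n -> 'I_n -> I).

Definition mx_of_coords (x : I -> R) : 'M[C]_n :=
  \matrix_(i, j) (x (coord true i j) +i* x (coord false i j)).

Lemma mx_of_coords_continuous : mx_continuous mx_of_coords.
Proof.
move=> i j; split.
  have -> : (fun x => complex.Re (mx_of_coords x i j)) = proj (coord true i j).
    by apply/funext => x; rewrite mxE.
  exact: (@proj_continuous I (fun=> R)).
have -> : (fun x => complex.Im (mx_of_coords x i j)) = proj (coord false i j).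
  by apply/funext => x; rewrite mxE.
exact: (@proj_continuous I (fun=> R)).
Qed.

End Coordinates.

Section Minimum.
Variables (d m : nat) (rho : 'I_m -> 'M[C]_d).
Hypothesis d_gt0 : (0 < d)%N.

Let n := (d * (d * d))%N.
(** A point of [I -> R], with the product topology, encodes both Choi matrices: the outer boolean
    chooses between J+ ([true]) and J- ([false]), the inner one between real and imaginary parts. *)
Let I : eqType := (bool * (bool * 'I_n * 'I_n))%type.
Let J (s : bool) (x : I -> R) : 'M[C]_n :=
  mx_of_coords (fun b i j => (s, (b, i, j))) x.

(* Taking the trace of Tr_SS'(J) = lambda 1_R determines lambda. *)
Let lam (K : 'M[C]_n) : R := d%:R^-1 * complex.Re (\tr K).

Let lamE (K : 'M[C]_n) (l : R) :
  @ptrace2 R d (d * d) K = (l%:C)%:M -> \tr K = (d%:R * l)%:C /\ lam K = l.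
Proof.
move=> Kl; have trK : \tr K = (d%:R * l)%:C.
  rewrite -(@trace_ptrace2 R d (d * d) K) Kl mxtrace_scalar -[LHS]mulr_natl.
  by rewrite rmorphM rmorph_nat.
by rewrite /lam trK /= mulKf // pnatr_eq0 -lt0n.
Qed.

Let J_continuous s : mx_continuous (J s).
Proof. exact: mx_of_coords_continuous. Qed.

Let lam_continuous s : continuous (fun x => lam (J s x)).
Proof.
have [trc _] : complex_continuous (fun x => \tr (J s x)).
  by apply: complex_continuous_sum => k; exact: J_continuous.
exact: (@scaled_continuous R _ d%:R^-1 _ trc).
Qed.

(** The multipliers are computed from the matrices rather than kept as coordinates, so bounding the
    matrix entries is enough for compactness. *)
Let feasible : set (I -> R) :=
  [set x | sdp_feasible rho (J true x) (J false x)
                        (lam (J true x)) (lam (J false x))].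

Let closed_feasible : closed feasible.
Proof.
exact: (@closed_sdp_feasible R _ d m rho _ _ _ _ (J_continuous true)
  (J_continuous false) (@lam_continuous true) (@lam_continuous false)).
Qed.

Let cost (x : I -> R) : R := lam (J true x) + lam (J false x).

Let cost_continuous : continuous cost.
Proof.
exact: (sum2_continuous (@lam_continuous true) (@lam_continuous false)).
Qed.

Let sdp_values_coords c : sdp_values rho c -> exists2 x, feasible x & c = cost x.
Proof.
move=> [Jp [Jm [lp [lm [JF ->]]]]].
pose x (k : I) : R :=
  let K := if k.1 then Jp else Jm in
  let z := K k.2.1.2 k.2.2 in if k.2.1.1 then complex.Re z else complex.Im z.
have Jpx : J true x = Jp.
  by apply/matrixP => i j; rewrite mxE /x /=; case: (Jp i j).
have Jmx : J false x = Jm.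
  by apply/matrixP => i j; rewrite mxE /x /=; case: (Jm i j).
have [_ /lamE[_ lpE] /lamE[_ lmE] _ _] := JF.
by exists x; rewrite /feasible /cost /= Jpx Jmx lpE lmE.
Qed.

Let box (M : R) : set (I -> R) := [set x | forall k, `[- M, M]%classic (x k)].

(** Both multipliers are nonnegative, so each is at most the cost, hence at most [c]. Every entry of
    a Choi matrix is bounded by its trace, which is [d] times its multiplier. *)
Let feasible_in_box c x : feasible x -> cost x <= c -> box (d%:R * c) x.
Proof.
move=> [_ trp trm psdp psdm] xc [s [[b i] j]].
have lamp_ge0 : 0 <= lam (J true x) := ptrace2_ge0 d_gt0 psdp trp.
have lamm_ge0 : 0 <= lam (J false x) := ptrace2_ge0 d_gt0 psdm trm.
have lam_le : lam (J s x) <= c.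
  by case: s; rewrite (le_trans _ xc) // /cost (lerDl, lerDr).
have psdJ : psdmx (J s x) by case: (s); [exact: psdp|exact: psdm].
have entry_le : `|J s x i j| <= (d%:R * c)%:C.
  apply: (@le_trans _ _ (\tr (J s x))).
    exact: (psdmx_entry_le_trace i j psdJ).
  have [-> _] : \tr (J s x) = (d%:R * lam (J s x))%:C /\ lam (J s x) = lam (J s x).
    by apply: lamE; case: (s).
  by rewrite lecR ler_wpM2l.
rewrite /= in_itv /= -ler_norml -lecR; apply: le_trans entry_le.
have -> : x (s, (b, i, j)) =
    if b then complex.Re (J s x i j) else complex.Im (J s x i j).
  by rewrite mxE; case: b.
by case: b; [exact: normc_ge_Re|exact: normc_Im_le].
Qed.

Lemma sdp_values_minimum c0 : sdp_values rho c0 ->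
  exists c, is_minimum (sdp_values rho) c.
Proof.
move=> c0_val; have [x0 x0F c0E] := sdp_values_coords c0_val.
(* The sublevel set at a known value [c0] is nonempty. It is a closed part of a box that is compact
   by Tychonoff, so the continuous cost attains its minimum there. *)
pose K := box (d%:R * c0) `&` (feasible `&` [set x | cost x <= c0]).
have K_compact : compact K.
  apply: compact_closedI.
    exact: (@tychonoff I (fun=> R) (fun=> `[- (d%:R * c0), d%:R * c0]%classic)
      (fun=> @segment_compact R _ _)).
  apply: (closedI closed_feasible).
  exact: (@closed_continuous_le R _ cost (fun=> c0) (@cost_continuous)
    (@cst_continuous _ _ c0)).
have KP x : feasible x -> cost x <= c0 -> K x.
  by move=> xF xc; split; [exact: feasible_in_box|].
have K_neq0 : K !=set0 by exists x0; apply: KP => //; rewrite c0E.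
have [x xK xmin] := compact_EVT_min K_neq0 K_compact
  (continuous_subspaceT cost_continuous).
have [_ [xF /= xc0]] : K x by rewrite inE in xK.
exists (cost x); split.
  by exists (J true x), (J false x), (lam (J true x)), (lam (J false x)).
move=> c c_val; have [y yF ->] := sdp_values_coords c_val.
(* A feasible point outside [K] costs more than [c0], hence at least [cost x]. *)
have [yc0|/ltW/(le_trans xc0)//] := leP (cost y) c0.
by apply: xmin; rewrite inE; exact: KP.
Qed.

End Minimum.
End Attainment.

(** * Equality of the optimal values *)

Lemma is_minimum_inf (R : realType) (A : set R) c : is_minimum A c -> inf A = c.
Proof.
move=> [Ac lbc]; apply/eqP; rewrite eq_le; apply/andP; split.
  by apply: ge_inf => //; exists c.
by apply: lb_le_inf => //; exists c.
Qed.

Theorem mainTheorem2 (R : realType) (d m : nat) (rho : 'I_m -> 'M[R[i]]_d)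
    (m_gt0 : (0 < m)%N) (rho_state : forall i : 'I_m, is_state (rho i))
    (rho_clonable : virtually_clonable rho) :
  [/\ is_minimum (cloning_costs rho) (optimal_cloning_cost rho),
      is_minimum (sdp_values rho) (sdp_optimal_value rho) &
      optimal_cloning_cost rho = sdp_optimal_value rho].
Proof.
have d_gt0 := is_state_dim_gt0 (rho_state (Ordinal m_gt0)).
have [c0 c0_val] := sdp_values_nonempty rho_clonable.
have [c c_min] := sdp_values_minimum d_gt0 c0_val.
(* Both optima become the infimum of one and the same set, which is its attained minimum [c]. *)
rewrite /optimal_cloning_cost /sdp_optimal_value cloning_costs_eq_sdp_values //.
by rewrite (is_minimum_inf c_min).
Qed.
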